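(* Consider the following algorithm for the (hyper)graphic matroid secretary problem on $\mathcal{M}[G]$, $G=(V,R)$: set $\mathrm{ALG}\gets\emptyset$, $A\gets\emptyset$, draw $s\sim\mathrm{Bin}(n,p)$; for $i=s+1,\dots,n$: if $r_i\in\mathrm{OPT}(R_i)$, let $a_i=(u_i,v_i)=\mathrm{arc}(r_i,\mathrm{OPT}(R_i))$, and if $\deg^-_A(u_i)=0=\deg^-_A(v_i)$ set $\mathrm{ALG}\gets\mathrm{ALG}+r_i$ and $A\gets A+a_i$; return $\mathrm{ALG}$. This algorithm has forbidden sets of size $2$. With $p=1/2$ it is $4$ probability-competitive for both graphic and hypergraphic matroids.
   Context: Hypergraphic matroid of a hypergraph $G=(V,R)$ ($|R|=n$): $X\subseteq R$ is independent iff one can choose, for each $r\in X$, a pair $\mathrm{edge}(r,X)=\{u(r),v(r)\}\subseteq r$ of vertices, all distinct over $r\in X$, forming a forest on $V$. For each independent $X$ such a choice is fixed canonically (independent of the arrival order); when $G$ is a graph, $\mathrm{edge}(r,X)=r$ (this is the graphic matroid: $X$ independent iff $(V,X)$ is a forest). The canonical orientation $\mathrm{arc}(X)$ is obtained by orienting each connected component of the forest $\{\mathrm{edge}(r,X):r\in X\}$ away from a (canonically chosen) root, so every vertex has indegree at most $1$; $\mathrm{arc}(r,X)$ is the oriented version of $\mathrm{edge}(r,X)$. $\deg^-_A(v)$ is the indegree of $v$ in arc set $A$. Ordinal MSP setting: total order $\succ$ on $R$; $\mathrm{OPT}(Q)$ is the greedy (lexicographically maximum w.r.t. $\succ$) base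 of $Q\subseteq R$, $\mathrm{OPT}=\mathrm{OPT}(R)$; edges arrive in uniformly random order $r_1,\dots,r_n$, $R_t=\{r_1,\dots,r_t\}$. Probability-competitive: $\Pr(e\in\mathrm{ALG})\ge1/\alpha$ for all $e\in\mathrm{OPT}$. Forbidden sets of size $k$: (1) output always independent; (2) draws $s\sim\mathrm{Bin}(n,p)$ and accepts none of the first $s$ elements; (3) for every $(X,Y,r^* )$ with $Y\subseteq R$, $r^*\in\mathrm{OPT}(Y)$, $X\subseteq Y\setminus\{r^*\}$ there is $\mathcal{F}(X,Y,r^* )\subseteq X$ with at most $k$ elements such that for every $t\ge s+1$, if $r_t\in\mathrm{OPT}(R_t)$ and $r_j\notin\mathcal{F}(R_j,R_t,r_t)$ for all $j\in\{s+1,\dots,t-1\}$ then $r_t$ is selected. *)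

(* Defs.v *)
From mathcomp Require Import all_boot all_order all_algebra.
From mathcomp Require Import reals binomial_distribution.

Set Implicit Arguments.
Unset Strict Implicit.
Unset Printing Implicit Defensive.

Import Order.TTheory GRing.Theory Num.Theory.

Local Open Scope ring_scope.

Section Forests.
Variable V : finType.
Implicit Type F : {set {set V}}.

Definition adjacent F : rel V := fun x y => (x != y) && ([set x; y] \in F).

(* Bounding the length of a simple cycle by #|V| only serves to make the
   predicate boolean, see [forestP]. *)
Definition forest F : bool :=
  [forall n : 'I_#|V|.+1, forall c : n.-tuple V,
     (2 < n)%N && uniq c ==> ~~ cycle (adjacent F) c].

Lemma forestP F :
  reflect (forall c : seq V, (2 < size c)%N -> uniq c ->
             ~~ cycle (adjacent F) c)
          (forest F).
Proof.
apply: (iffP forallP) => [Ff c c2 cu | Ff n].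
  have cV : (size c < #|V|.+1)%N by rewrite ltnS -(card_uniqP cu) max_card.
  move/forallP: (Ff (Ordinal cV)) => /(_ (in_tuple c)) /implyP; apply.
  by rewrite /= c2.
apply/forallP => c; apply/implyP => /andP[n2 cu].
by apply: Ff; rewrite ?size_tuple.
Qed.

End Forests.

(* The hyperedges of a hypergraph on V are the values of G : R -> {set V};
   parallel hyperedges are allowed. *)
Section Hypergraphic.
Variables (V R : finType) (G : R -> {set V}).
Implicit Types (X : {set R}) (e : R -> {set V}).

Definition represents X e : bool :=
  [&& [forall r in X, (#|e r| == 2)%N && (e r \subset G r)],
      dinjectiveb e X
    & forest (e @: X)].

Definition hypergraphic_indep : pred {set R} :=
  fun X => [exists e : {ffun R -> {set V}}, represents X e].

Definition is_graph : Prop := forall r, #|G r| = 2%N.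

Lemma graph_represents X e :
  is_graph -> represents X e -> {in X, e =1 G}.
Proof.
move=> G2 /and3P[/forall_inP eX _ _] r /eX /andP[/eqP e2 eG].
by apply/eqP; rewrite eqEcard eG e2 G2.
Qed.

Lemma graph_indepE X :
  is_graph -> hypergraphic_indep X = dinjectiveb G X && forest (G @: X).
Proof.
move=> G2; apply/existsP/andP => [[e eX] | [Gi Gf]].
  have eG := graph_represents G2 eX; case/and3P: eX => _ ei ef; split.
    apply/dinjectiveP => x y xX yX; rewrite -(eG x) // -(eG y) //.
    by move/dinjectiveP: ei; apply.
  by rewrite -(eq_in_imset eG).
exists (finfun G); apply/and3P; split.
- by apply/forall_inP => r _; rewrite ffunE G2 eqxx subxx.
- apply/dinjectiveP => x y xX yX; rewrite !ffunE.
  by move/dinjectiveP: Gi; apply.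
- by rewrite (eq_imset _ (ffunE G)).
Qed.

(* [edge X r] and [arc X r] are only constrained for X independent and r \in X;
   [root X v] is the root of the component of v, and an arc is a pair
   (tail, head).  The orientation is away from the roots, i.e., each vertex is
   reached from its root by a directed path. *)
Definition canonical_arcs (edge : {set R} -> R -> {set V})
    (root : {set R} -> V -> V) (arc : {set R} -> R -> V * V) : Prop :=
  forall X, hypergraphic_indep X ->
  let adj := adjacent (edge X @: X) in
  let arcs := arc X @: X in
  [/\ represents X (edge X),
      forall v, connect adj (root X v) v,
      forall u v, connect adj u v -> root X u = root X v,
      forall r, r \in X -> [set (arc X r).1; (arc X r).2] = edge X r
    & forall v, connect [rel x y | (x, y) \in arcs] (root X v) v].

End Hypergraphic.

Definition indegree (V : finType) (A : {set V * V}) (v : V) : nat :=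
  #|[set a in A | a.2 == v]|.

(* The elements of R are ranked by the order of R, larger being better. *)
Section OrdinalMSP.
Variables (K : realType) (disp : Order.disp_t) (R : finOrderType disp).
Variable I : pred {set R}.
Implicit Types (o : #|R|.-tuple R) (s t : nat) (Q X Y : {set R}).

Definition OPT Q : {set R} :=
  foldl (fun B r => if I (r |: B) then r |: B else B) set0
        (sort >=%O (enum Q)).

(* An arrival order is a duplicate-free tuple o; the (i+1)-st arriving element
   is [tnth o i], i : 'I_#|R|. *)
Definition arrived o t : {set R} := [set r in take t o].

(* [sample_law] is the law of the sample size s, drawn independently of the
   arrival order; [output s o] is the set of selected elements. *)
Record algorithm := Algorithm {
  sample_law : nat -> K;
  output : nat -> #|R|.-tuple R -> {set R} }.

Definition pr_selected (alg : algorithm) (r : R) : K :=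
  \sum_(s < #|R|.+1) sample_law alg s *
     (#|[set o : #|R|.-tuple R | uniq o & r \in output alg s o]|%:R
        / (#|R| `!)%:R).

Definition probability_competitive (alpha : K) (alg : algorithm) : Prop :=
  forall r, r \in OPT [set: R] -> alpha^-1 <= pr_selected alg r.

Definition has_forbidden_sets (p : K) (k : nat) (alg : algorithm) : Prop :=
  [/\ forall s o, (s <= #|R|)%N -> uniq o -> I (output alg s o),
      forall s, sample_law alg s = binomial_pmf #|R| p s,
      forall s o, (s <= #|R|)%N -> uniq o ->
        [disjoint output alg s o & arrived o s]
    & exists F : {set R} -> {set R} -> R -> {set R},
        (forall X Y r, r \in OPT Y -> X \subset Y :\ r ->
           F X Y r \subset X /\ (#|F X Y r| <= k)%N) /\
        (forall s o (i : 'I_#|R|), (s <= i)%N -> uniq o ->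
           tnth o i \in OPT (arrived o i.+1) ->
           (forall j : 'I_#|R|, (s <= j < i)%N ->
              tnth o j \notin
                F (arrived o j.+1) (arrived o i.+1) (tnth o i)) ->
           tnth o i \in output alg s o)].

End OrdinalMSP.

Section Algorithm.
Variables (K : realType) (V : finType) (disp : Order.disp_t).
Variables (R : finOrderType disp) (G : R -> {set V}).
Variable arc : {set R} -> R -> V * V.

Let opt : {set R} -> {set R} := OPT (hypergraphic_indep G).

(* The state is the pair (ALG, A). *)
Definition hypergraphic_step (o : #|R|.-tuple R) (S : {set R} * {set V * V})
    (i : 'I_#|R|) : {set R} * {set V * V} :=
  let r := tnth o i in
  let Q := arrived o i.+1 in
  let a := arc (opt Q) r in
  if [&& r \in opt Q, (indegree S.2 a.1 == 0)%N & (indegree S.2 a.2 == 0)%N]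
  then (r |: S.1, a |: S.2) else S.

Definition hypergraphic_output (s : nat) (o : #|R|.-tuple R) : {set R} :=
  (foldl (hypergraphic_step o) (set0, set0)
     [seq i : 'I_#|R| <- enum 'I_#|R| | (s <= i)%N]).1.

Definition hypergraphic_algorithm (p : K) : algorithm K R :=
  Algorithm (binomial_pmf #|R| p) hypergraphic_output.

End Algorithm.

(* Main.v *)
(* Selected arcs: whenever an arc is added both of its ends have indegree 0.  As
   each component of the selected forest has at most one vertex of indegree 0,
   the arc joins two components, so the output stays independent.  An earlier
   element can block r_t only if its arc enters one of the two ends of the arc
   of r_t; since every vertex has indegree at most 1 in arc(OPT(R_j)), at most
   two values of r_j do so.

   Competitiveness: reveal the arrival order backwards.  For a sample of size
   s >= 2, the optimal element sits at position i (from 0) and is selected in at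
   least s (s - 1) (n - 1)! / (i (i - 1)) of the n! orders.  Summing over i >= s
   gives probability at least s (n - s) / (n (n - 1)), whose mean for
   s ~ Bin(n, 1/2) is 1/4. *)
Require Import Defs.
From mathcomp Require Import all_boot all_order all_algebra.
From mathcomp Require Import reals binomial_distribution.
From mathcomp Require Import ring lra zify.

Set Implicit Arguments.
Unset Strict Implicit.
Unset Printing Implicit Defensive.

Import Order.TTheory GRing.Theory Num.Theory.

(** * Forests *)

Section ForestTheory.
Variable V : finType.
Implicit Types (F : {set {set V}}) (u v x y : V).

Local Notation conn F := (connect (adjacent F)).

Lemma adjacent_sym F : symmetric (adjacent F).
Proof. by move=> x y; rewrite /adjacent eq_sym setUC. Qed.

Lemma conn_sym F : connect_sym (adjacent F).
Proof. exact/sym_connect_sym/adjacent_sym. Qed.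

Lemma connS F F' : F \subset F' -> subrel (conn F) (conn F').
Proof.
move=> sFF'; apply: connect_sub => x y /andP[xy xyF].
by apply: connect1; rewrite /adjacent xy (subsetP sFF').
Qed.

Lemma set2_inj (x y u v : V) :
  [set x; y] = [set u; v] -> x != y -> (x = u /\ y = v) \/ (x = v /\ y = u).
Proof.
move=> /setP e xy.
have := e x; have := e y; rewrite !inE !eqxx orbT /= => /esym + /esym.
have := e u; have := e v; rewrite !inE !eqxx orbT /=.
case/orP => [/eqP->|/eqP->]; case/orP => /eqP uE; subst;
  case/orP => /eqP yE; case/orP => /eqP xE; subst; rewrite ?eqxx in xy *; auto.
Qed.

(** A walk that crosses the new pair several times can be shortened to one that crosses it at most
    once, in one of the two directions. *)
Lemma conn_setU1 F u v x y : conn ([set u; v] |: F) x y ->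
  [\/ conn F x y, conn F x u /\ conn F v y | conn F x v /\ conn F u y].
Proof.
case/connectP=> p; elim: p x => [|z p IH] x /=; first by move=> _ ->; constructor 1.
case/andP=> /andP[xz]; rewrite inE in_set1 => xzF zp yp.
case/orP: xzF => [/eqP/set2_inj/(_ xz)|xzF].
  case=> -[xE zE]; subst x z.
    case: (IH _ zp yp) => [vy|[_ vy]|[_ uy]]; first by constructor 2.
      by constructor 2.
    by constructor 1.
  case: (IH _ zp yp) => [vy|[_ vy]|[_ uy]]; first by constructor 3.
    by constructor 1.
  by constructor 3.
have xzc : conn F x z by apply: connect1; rewrite /adjacent xz.
case: (IH _ zp yp) => [zy|[zu vy]|[zv uy]].
- by constructor 1; apply: connect_trans zy.
- by constructor 2; split=> //; apply: connect_trans zu.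
- by constructor 3; split=> //; apply: connect_trans zv.
Qed.

(** A simple path between the ends of a pair that avoids the pair closes up to a cycle, and
    conversely each pair of a cycle is bypassed by the rest of it. Later arguments use this
    connectivity form instead of cycles. *)
Lemma forest_bridgeP F :
  reflect (forall u v, u != v -> [set u; v] \in F ->
             ~~ conn (F :\ [set u; v]) u v)
          (forest F).
Proof.
apply: (iffP (forestP F)) => [Ff u v uv uvF|Fb].
  apply/negP => /connectP[p0 /shortenP[p up Up _] vE] {p0}.
  have uvN : ~~ adjacent (F :\ [set u; v]) u v by rewrite /adjacent !inE eqxx andbF.
  have p2 : 2 < size (u :: p).
    case: p up Up vE => [|a [|b p]] //= up _ vE; first by rewrite vE eqxx in uv.
    by rewrite -vE (negbTE uvN) in up.
  move/negP: (Ff _ p2 Up); apply; rewrite /= rcons_path -vE adjacent_sym.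
  rewrite {2}/adjacent uv uvF !andbT.
  by apply: sub_path up => a b /andP[ab]; rewrite !inE /adjacent ab => /andP[].
case=> [|x [|y [|z p]]] //= _ /andP[xnp /andP[ynp _]].
rewrite rcons_path; apply/negP => /and4P[/andP[xy xyF] yz zp /andP[lx lxF]].
move/negP: (Fb x y xy xyF); apply.
set e := [set x; y] in xyF *; set l := last z p in lx lxF *.
(* The cycle minus its first pair leads from [y] through [z] to [l] and back to [x]. Only its last
   pair contains [x], and that one differs from [[set x; y]] because [l] is not [y]. *)
have lnx : l != y.
  by apply: contraNneq ynp => <-; rewrite /l mem_last.
rewrite conn_sym; apply: (@connect_trans _ _ l).
  apply/connectP; exists (z :: p) => //.
  have : path (adjacent F) y (z :: p) by rewrite /= yz zp.
  apply: (@sub_in_path _ (mem (y :: z :: p)) (adjacent F)); last first.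
    by apply/allP.
  move=> a b ain bin /andP[ab abF]; rewrite /adjacent ab !inE abF andbT /=.
  have {}ain : a \in y :: z :: p by [].
  have {}bin : b \in y :: z :: p by [].
  apply: contraNneq xnp => /set2_inj/(_ ab)[[<- _]|[_ <-]] //.
apply: connect1; rewrite /adjacent lx !inE lxF andbT /=.
apply: contraNneq lnx => /set2_inj/(_ lx)[[ex _]|[-> //]].
by rewrite ex eqxx in lx.
Qed.

Lemma forestS F F' : F \subset F' -> forest F' -> forest F.
Proof.
move=> sFF' /forest_bridgeP Ff'; apply/forest_bridgeP => u v uv uvF.
apply: contra (Ff' u v uv (subsetP sFF' _ uvF)).
by apply: connS; apply: setSD.
Qed.

(** If deleting an old pair left its ends connected, the connection would use the new pair, and then
    [u] and [v] would be connected in [F] through the old one. *)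
Lemma forest_setU1 F u v :
  ~~ conn F u v -> forest F -> forest ([set u; v] |: F).
Proof.
move=> uvN Ff; apply/forest_bridgeP => a b ab.
have [abE _|abuv] := eqVneq [set a; b] [set u; v].
  apply: contra uvN; rewrite abE => abc.
  have {abc} : conn F a b.
    by apply: connS abc; apply/subsetP => f; rewrite !inE => /andP[/negbTE->].
  case: (set2_inj abE ab) => -[<- <-] //; by rewrite conn_sym.
rewrite !inE (negbTE abuv) /= => abF.
have abN := forest_bridgeP _ Ff a b ab abF.
have -> : ([set u; v] |: F) :\ [set a; b] = [set u; v] |: (F :\ [set a; b]).
  apply/setP => f; rewrite !inE; case: eqVneq => //= ->.
  by rewrite (negbTE abuv).
apply/negP; have sF : F :\ [set a; b] \subset F by apply: subsetDl.
have abc : conn F a b by apply: connect1; rewrite /adjacent ab.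
case/conn_setU1 => [|[/(connS sF) au /(connS sF) vb]|[/(connS sF) av /(connS sF) ub]].
- exact/negP.
- move/negP: uvN; apply; rewrite (conn_sym F) in au.
  rewrite (conn_sym F) in vb.
  by apply: connect_trans au _; apply: connect_trans abc vb.
- move/negP: uvN; apply; rewrite (conn_sym F) in abc.
  by apply: connect_trans ub _; apply: connect_trans abc av.
Qed.

(** Components are counted by representatives; [fingraph.root] is unrelated to the roots of a
    canonical orientation. *)
Definition ncomps F : nat := #|[set fingraph.root (adjacent F) x | x in V]|.

(** Any labelling that separates exactly the components counts them, so other representatives may be
    used. *)
Lemma ncomps_fun F (T : finType) (g : V -> T) :
  (forall x y, (g x == g y) = conn F x y) -> ncomps F = #|[set g x | x in V]|.
Proof.
move=> gP; set r := fingraph.root (adjacent F).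
have gr x : g (r x) = g x by apply/eqP; rewrite gP conn_sym connect_root.
have -> : [set g x | x in V] = g @: [set r x | x in V].
  by rewrite -imset_comp; apply: eq_imset => x /=; rewrite gr.
rewrite card_in_imset // => _ _ /imsetP[x _ ->] /imsetP[y _ ->].
rewrite !gr => /eqP; by rewrite gP => /(fingraph.rootP (conn_sym F)).
Qed.

Lemma ncomps_setU1 F u v :
  ~~ conn F u v -> ncomps F = (ncomps ([set u; v] |: F)).+1.
Proof.
move=> uvN; set F' := _ |: F; set r := fingraph.root (adjacent F).
have sFF' : F \subset F' by apply: subsetUr.
have uv : u != v by apply: contraNneq uvN => ->.
have uvF' : conn F' u v by apply: connect1; rewrite /adjacent uv !inE eqxx.
have rE x y : (r x == r y) = conn F x y by apply: root_connect; apply: conn_sym.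
(* The component of [v] takes the label of the component of [u], so exactly the label [r v]
   disappears. *)
pose g x := if conn F x v then r u else r x.
rewrite (@ncomps_fun F' _ g) => [|x y]; last first.
  apply/idP/idP => [|/conn_setU1].
    rewrite /g; case: ifP => xv; case: ifP => yv; rewrite ?rE => h.
    - by apply: (connS sFF'); rewrite (conn_sym F) in yv; apply: connect_trans xv yv.
    - apply: (connect_trans (connS sFF' xv)); rewrite (conn_sym F') in uvF'.
      by apply: (connect_trans uvF'); apply: (connS sFF').
    - apply: (connect_trans (connS sFF' h)); apply: (connect_trans uvF').
      by rewrite (conn_sym F'); apply: (connS sFF').
    - exact: (connS sFF').
  have uvN' : conn F u v = false by apply: negbTE.
  rewrite /g; case=> [xy|[xu vy]|[xv uy]].
  - by rewrite (same_connect (conn_sym F) xy); case: ifP => // _; rewrite rE.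
  - rewrite (same_connect (conn_sym F) xu) uvN' (conn_sym F y) vy rE //.
  - rewrite -(same_connect (conn_sym F) uy) uvN' xv rE //.
rewrite /ncomps -/r; have rv : r v \in [set r x | x in V] by apply: imset_f.
rewrite (cardsD1 (r v)) rv add1n; congr _.+1; apply: eq_card => w.
rewrite in_setD1; apply/andP/imsetP => [[wv /imsetP[x _ wE]]|[x _ ->]].
  exists x; rewrite // /g; case: ifP => // xv.
  by move: wv; rewrite wE rE xv.
rewrite /g; case: ifP => xv; rewrite ?rE ?xv ?uvN; split=> //; exact: imset_f.
Qed.

Lemma ncompsS F F' : subrel (conn F) (conn F') -> ncomps F' <= ncomps F.
Proof.
move=> sFF'; set r := fingraph.root (adjacent F'); rewrite /ncomps -/r.
have -> : [set r x | x in V] = r @: [set fingraph.root (adjacent F) x | x in V].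
  rewrite -imset_comp; apply: eq_imset => x /=.
  by apply/fingraph.rootP; [apply: conn_sym | apply: sFF'; apply: connect_root].
exact: leq_imset_card.
Qed.

(** Each pair of a forest is a bridge, so removing it creates exactly one more component. *)
Lemma card_forest F : {in F, forall f : {set V}, #|f| = 2} -> forest F ->
  #|F| + ncomps F = #|V|.
Proof.
have [n] := ubnP #|F|; elim: n F => // n IH F Fn F2 Ff.
have [->|/set0Pn[f fF]] := eqVneq F set0.
  rewrite cards0 (@ncomps_fun _ _ id); first by rewrite add0n card_imset //; apply: inj_id.
  move=> x y; apply/eqP/idP => [->//|/connectP[[|z p] //=]].
  by rewrite /adjacent inE andbF.
have /cards2P[u [v [uv fE]]] : #|f| == 2 by rewrite F2.
have uvN : ~~ conn (F :\ f) u v.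
  by rewrite fE; apply: (forest_bridgeP _ Ff) => //; rewrite -fE.
have FE : F = [set u; v] |: (F :\ f) by rewrite -fE setD1K.
have := IH (F :\ f); rewrite (ncomps_setU1 uvN) -FE addnS -addSn.
rewrite (cardsD1 f F) fF add1n in Fn *; apply=> //.
  by move=> g; rewrite !inE => /andP[_ /F2].
by apply: forestS Ff; apply: subsetDl.
Qed.

(** If no pair of [F'] extends [F], each of them lies within a component of [F]. Then [F] has at
    most as many components as [F'], and by [card_forest] at least as many pairs. *)
Lemma forest_augment F F' :
  {in F, forall f : {set V}, #|f| = 2} -> {in F', forall f : {set V}, #|f| = 2} ->
  forest F -> forest F' -> #|F| < #|F'| ->
  exists2 f, f \in F' :\: F & forest (f |: F).
Proof.
move=> F2 F2' Ff Ff' ltFF'.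
have [/exists_inP[f fF' fF]|/exists_inPn h] :=
  boolP [exists f in F' :\: F, forest (f |: F)]; first by exists f.
have /ncompsS : subrel (conn F') (conn F).
  apply: connect_sub => x y /andP[xy xyF']; apply/negPn/negP => xyN.
  have := h [set x; y]; rewrite inE xyF' andbT forest_setU1 // => /(_ _)/negP.
  apply=> //; apply: contra xyN => xyF; apply: connect1.
  by rewrite /adjacent xy.
rewrite leqNgt => /negP[]; rewrite -(ltn_add2l #|F|) card_forest //.
by rewrite -(card_forest F2' Ff') ltn_add2r.
Qed.

End ForestTheory.

(** * The hypergraphic matroid and greedy bases *)

Section HypergraphicTheory.
Variables (V R : finType) (G : R -> {set V}).
Implicit Types (X Y : {set R}) (e : R -> {set V}).

Lemma representsP X e :
  reflect [/\ {in X, forall r, #|e r| = 2}, {in X, forall r, e r \subset G r},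
              {in X &, injective e} & forest (e @: X)]
          (represents G X e).
Proof.
apply: (iffP and3P) => [[/forall_inP h /dinjectiveP ei ef]|[e2 eG ei ef]].
  by split=> // r /h /andP[/eqP].
split=> //; last exact/dinjectiveP.
by apply/forall_inP => r rX; rewrite e2 // eqxx eG.
Qed.

Lemma represents_pairs X e :
  represents G X e -> {in e @: X, forall f : {set V}, #|f| = 2}.
Proof. by case/representsP => e2 _ _ _ _ /imsetP[r rX ->]; apply: e2. Qed.

Lemma representsS X Y e : X \subset Y -> represents G Y e -> represents G X e.
Proof.
move=> /[dup] sXY /subsetP XY /representsP[e2 eG ei ef]; apply/representsP; split.
- by move=> r /XY; apply: e2.
- by move=> r /XY; apply: eG.
- by move=> x y /XY xY /XY yY; apply: ei.
- by apply: forestS ef; apply: imsetS.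
Qed.

Lemma eq_represents X e e' : {in X, e =1 e'} -> represents G X e ->
  represents G X e'.
Proof.
move=> ee' /representsP[e2 eG ei ef]; apply/representsP; split.
- by move=> r rX; rewrite -ee' ?e2.
- by move=> r rX; rewrite -ee' ?eG.
- by move=> x y xX yX; rewrite -!ee' //; apply: ei.
- by rewrite -(eq_in_imset ee').
Qed.

Lemma represents_indep X e : represents G X e -> hypergraphic_indep G X.
Proof.
move=> eX; apply/existsP; exists (finfun e).
by apply: eq_represents eX => r _; rewrite ffunE.
Qed.

Lemma hypergraphic_indep0 : hypergraphic_indep G set0.
Proof.
apply: (@represents_indep _ (fun=> set0)); apply/representsP.
split; try by move=> r; rewrite inE.
rewrite imset0; apply/forest_bridgeP => u v _; by rewrite inE.
Qed.

Lemma hypergraphic_indepS X Y :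
  X \subset Y -> hypergraphic_indep G Y -> hypergraphic_indep G X.
Proof. by move=> XY /existsP[e /(representsS XY)]; apply: represents_indep. Qed.

(** Working with [X :\ r] covers two cases at once: adding a new hyperedge [r], and switching the
    pair of an [r] already in [X]. *)
Lemma represents_setU1 X e r f :
  represents G (X :\ r) e -> f \notin e @: (X :\ r) ->
  #|f| = 2 -> f \subset G r -> forest (f |: e @: (X :\ r)) ->
  represents G (r |: X) (fun x => if x == r then f else e x).
Proof.
move=> /representsP[e2 eG ei ef] fN f2 fG ff; set e1 := fun x => _.
have e1E : {in X :\ r, e1 =1 e} by move=> x; rewrite !inE /e1 => /andP[/negbTE->].
have rXE : r |: X = r |: (X :\ r).
  by apply/setP => x; rewrite !inE; case: eqP.
have e1r : e1 r = f by rewrite /e1 eqxx.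
rewrite rXE; apply/representsP; split.
- by move=> x /setU1P[->|xX]; rewrite ?e1r // e1E // e2.
- by move=> x /setU1P[->|xX]; rewrite ?e1r // e1E // eG.
- move=> x y /setU1P[->|xX] /setU1P[->|yX] //; rewrite ?e1r ?e1E //.
  + by move=> fE; rewrite fE imset_f in fN.
  + by move=> fE; rewrite -fE imset_f in fN.
  + exact: ei.
- by rewrite imsetU1 e1r (eq_in_imset e1E).
Qed.

(* If the pair that extends the forest of [X] belongs to a hyperedge that [X]
   already contains, that hyperedge switches to this pair, which brings the
   representation of [X] closer to the one of [Y]. *)
Lemma hypergraphic_augment X Y :
  hypergraphic_indep G X -> hypergraphic_indep G Y -> #|X| < #|Y| ->
  exists2 r, r \in Y :\: X & hypergraphic_indep G (r |: X).
Proof.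
case/existsP => e0; move: (fun_of_fin e0) => e {e0} eX.
case/existsP => e' e'Y ltXY.
have [n] := ubnP #|[set r in X :&: Y | e r != e' r]|.
elim: n e eX => // n IH e eX lt_n.
have [e2 eG ei ef] := representsP _ _ eX.
have [e2' eG' ei' ef'] := representsP _ _ e'Y.
have [||//|//||f] := @forest_augment _ (e @: X) (e' @: Y).
- exact: represents_pairs eX.
- exact: represents_pairs e'Y.
- by rewrite !card_in_imset.
case/setDP => /imsetP[r rY ->{f}] rN fr.
have sXr : X :\ r \subset X by apply: subsetDl.
have eX1 : represents G (r |: X) (fun x => if x == r then e' r else e x).
  apply: represents_setU1.
  - exact: representsS eX.
  - by apply: contra rN => /(subsetP (imsetS e sXr)).
  - exact: e2'.
  - exact: eG'.
  - by apply: forestS fr; apply: setUS; apply: imsetS.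
have [rX|rX] := boolP (r \in X); last first.
  by exists r; [rewrite inE rX | apply: represents_indep eX1].
have rXE : r |: X = X by apply/setUidPr; rewrite sub1set.
rewrite rXE in eX1; apply: IH eX1 _; rewrite -ltnS; apply: leq_trans lt_n.
rewrite ltnS; apply: proper_card; apply/properP; split.
  apply/subsetP => x; rewrite !inE; case: (eqVneq x r) => [->|//].
  by rewrite eqxx andbF.
exists r; rewrite !inE rX rY /= ?eqxx //.
by apply: contraNneq rN => <-; apply: imset_f.
Qed.

End HypergraphicTheory.

(** * Indegrees in the canonical orientation *)

Section Arcs.
Variables (V R : finType) (G : R -> {set V}).

(* Every vertex other than a root has indegree at least 1, and there are
   exactly as many arcs as such vertices. *)
Lemma canonical_arcs_indegree edge root arc (X : {set R}) (v : V) :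
  canonical_arcs G edge root arc -> hypergraphic_indep G X ->
  #|[set r in X | (arc X r).2 == v]| <= 1.
Proof.
move=> ca Xi; have [eX rootc rootE _ rootarc] := ca X Xi.
have [_ _ ei ef] := representsP _ _ _ eX.
set E := edge X @: X in rootc rootE ef.
pose d v := #|[set r in X | (arc X r).2 == v]|; rewrite -/(d v).
pose nr v : nat := root X v != v.
(* A vertex that is not a root is entered by the last arc of the directed path from its root. *)
have nrd w : nr w <= d w.
  rewrite /nr; case: eqVneq => //= rw; rewrite card_gt0; apply/set0Pn.
  have /connectP[p] := rootarc w; case: (lastP p) => [|q z] pq.
    by move=> /= wE; case/eqP: rw.
  rewrite last_rcons => wE; rewrite -wE rcons_path in pq.
  case/andP: pq => _ /= /imsetP[r rX rE].
  by exists r; rewrite inE rX -rE /=.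
have sumd : \sum_w d w = #|X|.
  rewrite -sum1_card (partition_big (fun r => (arc X r).2) predT) //=.
  by apply: eq_bigr => w _; rewrite /d -sum1_card; apply: eq_bigl => r; rewrite inE.
have cE : #|X| + ncomps E = #|V|.
  by rewrite -(card_forest (represents_pairs eX) ef) card_in_imset.
(* Connected vertices share their root, so distinct roots lie in distinct components. *)
have roots : #|[set w | root X w == w]| <= ncomps E.
  rewrite -(@card_in_imset _ _ (fingraph.root (adjacent E))).
    by apply: subset_leq_card; apply/subsetP => _ /imsetP[w _ ->]; apply: imset_f.
  move=> x y; rewrite !inE => /eqP xr /eqP yr.
  by move/(fingraph.rootP (@conn_sym _ _))/rootE; rewrite xr yr.
have sumnr : \sum_w nr w + #|[set w | root X w == w]| = #|V|.
  rewrite -(cardsC [set w | root X w == w]) addnC; congr (_ + _).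
  rewrite -sum1_card [RHS]big_mkcond /=; apply: eq_bigr => w _.
  by rewrite !inE /nr; case: (_ == _).
have le_sum : \sum_w d w <= \sum_w nr w.
  by rewrite sumd -(leq_add2r (ncomps E)) cE -sumnr leq_add2l.
(* As [nr] is pointwise at most [d] while its sum is at least that of [d], the two agree at [v]. *)
apply: (@leq_trans (nr v)); last exact: leq_b1.
rewrite -(leq_add2r (\sum_(w | w != v) nr w)).
move: le_sum; rewrite (bigD1 v) //= [X in _ <= X](bigD1 v) //=.
by apply: leq_trans; rewrite leq_add2l leq_sum.
Qed.

End Arcs.

(** * Greedy bases of a matroid *)

Section GreedyBase.
Variables (disp : Order.disp_t) (R : finOrderType disp) (I : pred {set R}).
Hypothesis I0 : I set0.
Hypothesis IS : forall X Y : {set R}, X \subset Y -> I Y -> I X.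
Hypothesis augment : forall X Y : {set R}, I X -> I Y -> #|X| < #|Y| ->
  exists2 r, r \in Y :\: X & I (r |: X).
Implicit Types (B X Y Q S : {set R}) (l : seq R).

(** The fold of [OPT] from an arbitrary state, so that a run can be cut at a given element. *)
Definition greedy B l : {set R} :=
  foldl (fun B r => if I (r |: B) then r |: B else B) B l.

Lemma greedy_sub B l : B \subset greedy B l.
Proof.
elim: l B => //= r l IH B; case: ifP => _ //.
exact: subset_trans (subsetUr _ _) (IH _).
Qed.

Lemma sub_greedy B l : greedy B l \subset B :|: [set r in l].
Proof.
elim: l B => [|r l IH] B /=; first exact: subsetUl.
apply: (subset_trans (IH _)); case: ifP => _; apply/subsetP => x; rewrite !inE.
  by case: (x == r); case: (x \in B); case: (x \in l).
by case: (x == r); case: (x \in B); case: (x \in l).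
Qed.

Lemma greedy_indep B l : I B -> I (greedy B l).
Proof. by elim: l B => //= r l IH B IB; case: ifP => ?; apply: IH. Qed.

(** The set only grows and independence is hereditary, so an element rejected once never fits
    later. *)
Lemma greedy_max B l x : x \in l -> I (x |: greedy B l) -> x \in greedy B l.
Proof.
elim: l B => //= r l IH B; rewrite in_cons => /orP[/eqP->|xl]; last exact: IH.
move=> Ix; case: ifP => [_|/negP[]].
  by apply: (subsetP (greedy_sub _ _)); rewrite setU11.
apply: IS Ix; apply: setUS; case: ifP => _; last exact: greedy_sub.
exact: subset_trans (subsetUr _ _) (greedy_sub _ _).
Qed.

Lemma OPT_sub Q : OPT I Q \subset Q.
Proof.
apply: (subset_trans (sub_greedy _ _)); rewrite set0U.
by apply/subsetP => x; rewrite inE mem_sort mem_enum.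
Qed.

Lemma OPT_indep Q : I (OPT I Q).
Proof. exact: greedy_indep. Qed.

(** Extend [X] to a maximal independent [Z] within [S]. Augmentation of [B] shows that [Z] is no
    larger than [B], so [r |: B] augments [Z]; by maximality of [Z] the added element can only be
    [r]. *)
Lemma maximal_span S B X r :
  I B -> B \subset S -> (forall x, x \in S -> I (x |: B) -> x \in B) ->
  r \notin S -> I (r |: B) -> I X -> X \subset S -> I (r |: X).
Proof.
move=> IB BS Bmax rS IrB IX XS; apply/negPn/negP => rXN.
pose P (Z : {set R}) := [&& I Z, X \subset Z & Z \subset S].
have PX : P X by rewrite /P IX subxx.
have [Z /maxsetP[/and3P[IZ XZ ZS] Zmax] _] := maxset_exists PX.
have rB : r \notin B by apply: contra rS; apply: (subsetP BS).
have rZN : ~ I (r |: Z) by move=> IrZ; move/negP: rXN; apply; apply: IS IrZ; apply: setUS.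
have [ltBZ|leZB] := ltnP #|B| #|Z|.
  have [x /setDP[xZ xB] IxB] := augment IB IZ ltBZ.
  by move/negP: xB; apply; apply: Bmax => //; apply: (subsetP ZS).
have ltZ : #|Z| < #|r |: B| by rewrite cardsU1 rB add1n ltnS.
have [x /setDP[/setU1P[->//|xB] xZ] IxZ] := augment IZ IrB ltZ.
move/negP: xZ; apply; rewrite -(Zmax (x |: Z)) ?setU11 ?subsetUr //.
rewrite /P IxZ (subset_trans XZ (subsetUr _ _)) subUset sub1set ZS andbT /=.
exact: (subsetP BS).
Qed.

(** When the greedy procedure reaches [r] it has seen exactly the better elements, and its decision
    on [r] is final. *)
Lemma mem_OPT Q r : r \in Q ->
  (r \in OPT I Q) =
  I (r |: greedy set0 (sort >=%O (enum [set x in Q | (r < x)%O]))).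
Proof.
move=> rQ; set L := sort >=%O (enum Q).
have Lsort : sorted >=%O L by apply: sort_sorted => x y; apply: le_total.
have Luniq : uniq L by rewrite sort_uniq enum_uniq.
have rL : r \in L by rewrite mem_sort mem_enum.
have LE : sort >=%O (enum [set x in Q | (r < x)%O]) = [seq x <- L | (r < x)%O].
  rewrite filter_sort; last 2 first.
  - by move=> x y; apply: le_total.
  - by move=> x y z xy yz; apply: le_trans yz xy.
  congr sort; rewrite /enum_mem -filter_predI; apply: eq_filter => x /=.
  by rewrite !inE andbC.
rewrite LE {LE} /OPT -/(greedy _ _) -/L; case/splitPr: rL Lsort Luniq => l1 l2.
rewrite sorted_pairwise; last by move=> x y z xy yz; apply: le_trans yz xy.
rewrite pairwise_cat pairwise_cons allrel_consr cat_uniq /= negb_or.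
case/and3P => /andP[/allP rl1 _] _ /andP[/allP rl2 _].
case/and4P => _ /andP[rNl1 _] rNl2 _.
have -> : [seq x <- l1 ++ r :: l2 | (r < x)%O] = l1.
  rewrite filter_cat /= ltxx; have /eq_in_filter-> : {in l2, (fun x => r < x)%O =1 pred0}.
    by move=> x /rl2 /= xr; rewrite ltNge xr.
  rewrite filter_pred0 cats0; apply/all_filterP/allP => x xl1.
  by rewrite lt_neqAle eq_sym (memPn rNl1) ?rl1.
rewrite /greedy foldl_cat /= -/(greedy _ l1) -/(greedy _ l2); set B := greedy _ l1.
have rB : r \notin B.
  by apply: contra rNl1 => /(subsetP (sub_greedy _ _)); rewrite !inE.
case: ifP => [_|_]; first by apply/idP; apply: (subsetP (greedy_sub _ _)); rewrite setU11.
by apply/negP => /(subsetP (sub_greedy _ _)); rewrite !inE (negbTE rB) (negbTE rNl2).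
Qed.

(** The greedy set of all elements better than [r] is maximal among them and still admits [r]. By
    [maximal_span], so does the greedy set of those in [Q]. *)
Lemma OPT_restrict Q r : r \in OPT I [set: R] -> r \in Q -> r \in OPT I Q.
Proof.
move=> rO rQ; move: rO; rewrite !mem_OPT ?inE //.
set L := sort _ _; set l := sort _ _ => IL.
have memL x : (x \in L) = (r < x)%O by rewrite mem_sort mem_enum !inE.
have meml x : (x \in l) = (x \in Q) && (r < x)%O by rewrite mem_sort mem_enum !inE.
apply: (@maximal_span [set x in L] _ _ _ _ _ _ _ IL); rewrite ?inE ?memL ?ltxx //.
- exact: greedy_indep.
- by have := sub_greedy set0 L; rewrite set0U.
- by move=> x; rewrite inE => xL; apply: greedy_max.
- exact: greedy_indep.
- apply: (subset_trans (sub_greedy _ _)); rewrite set0U.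
  by apply/subsetP => x; rewrite !inE meml memL => /andP[].
Qed.

End GreedyBase.

(** * Forbidden sets *)

Lemma indegree_eq0 (V : finType) (A : {set V * V}) v :
  reflect (forall a, a \in A -> a.2 != v) (indegree A v == 0).
Proof.
rewrite cards_eq0; apply: (iffP eqP) => [/setP A0 a aA|A0].
  by have := A0 a; rewrite !inE aA /= => ->.
by apply/setP => a; rewrite !inE; apply/andP => -[/A0/negP].
Qed.

Section Arrival.
Variables (disp : Order.disp_t) (R : finOrderType disp).
Implicit Types (o : #|R|.-tuple R).

Lemma tnth_inj o : uniq o -> injective (tnth o).
Proof. by move/tuple_uniqP. Qed.

Lemma arrivedP o t r :
  uniq o -> reflect (exists2 i : 'I_#|R|, i < t & r = tnth o i)
                    (r \in arrived o t).
Proof.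
move=> uo; rewrite inE; apply: (iffP idP) => [rt|[i it ->]].
  have /tnthP[i ri] := mem_take rt; exists i => //.
  move: rt; rewrite ri (tnth_nth r) in_take ?mem_nth ?size_tuple //.
  by rewrite index_uniq ?size_tuple.
rewrite (tnth_nth (tnth o i)) in_take ?mem_nth ?size_tuple //.
by rewrite index_uniq ?size_tuple.
Qed.

(** Expresses a prefix set through the later arrivals, as needed when the order is revealed
    backwards. *)
Lemma arrivedE o t :
  uniq o -> arrived o t = ~: [set r in drop t o].
Proof.
move=> uo; apply/setP => r; rewrite !inE.
have rT : r \in o.
  have oR : #|o| = #|R| by rewrite (card_uniqP uo) size_tuple.
  have /(subset_cardP oR) -> // : o \subset R by apply/subsetP.
have {}rT : r \in take t o ++ drop t o by rewrite cat_take_drop.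
move: uo rT; rewrite -{1}(cat_take_drop t o) cat_uniq mem_cat.
case/and3P => _ /hasPn h _.
case: (boolP (r \in take t o)) => /= [rt _|_ -> //].
by symmetry; apply/negP => /h /=; rewrite rt.
Qed.

End Arrival.

Section ForbiddenSets.
Variables (K : realType) (V : finType) (disp : Order.disp_t).
Variables (R : finOrderType disp) (G : R -> {set V}).
Variables (edge : {set R} -> R -> {set V}) (root : {set R} -> V -> V).
Variable arc : {set R} -> R -> V * V.
Hypothesis ca : canonical_arcs G edge root arc.

Local Notation opt := (OPT (hypergraphic_indep G)).
Local Notation step := (hypergraphic_step G arc).
Local Notation run o := (foldl (step o) (set0, set0)).
Implicit Types (o : #|R|.-tuple R) (l : seq 'I_#|R|).

Let opt_indep Q : hypergraphic_indep G (opt Q).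
Proof. by apply: OPT_indep; apply: hypergraphic_indep0. Qed.

Let opt_sub Q : opt Q \subset Q.
Proof. exact: OPT_sub. Qed.

Lemma run_selected o l r : r \in (run o l).1 -> exists2 i, i \in l & r = tnth o i.
Proof.
elim/last_ind: l => [|l i IH]; first by rewrite inE.
rewrite foldl_rcons {1}/hypergraphic_step.
have {}IH : r \in (run o l).1 -> exists2 j, j \in rcons l i & r = tnth o j.
  by case/IH => j jl ->; exists j; rewrite // mem_rcons inE jl orbT.
case: ifP => // _ /setU1P[->|//]; exists i => //.
by rewrite mem_rcons mem_head.
Qed.

Lemma run_arcs o l a : a \in (run o l).2 ->
  exists i : 'I_#|R|, [/\ i \in l, tnth o i \in opt (arrived o i.+1) &
                a = arc (opt (arrived o i.+1)) (tnth o i)].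
Proof.
elim/last_ind: l => [|l i IH]; first by rewrite inE.
rewrite foldl_rcons {1}/hypergraphic_step.
have {}IH : a \in (run o l).2 -> exists j : 'I_#|R|,
  [/\ j \in rcons l i, tnth o j \in opt (arrived o j.+1) &
                a = arc (opt (arrived o j.+1)) (tnth o j)].
  by case/IH => j [jl jO ->]; exists j; rewrite mem_rcons inE jl orbT.
case: ifP => // /andP[iO _] /setU1P[->|//]; exists i; split=> //.
by rewrite mem_rcons mem_head.
Qed.

Lemma run_mono o l l' : (run o l).1 \subset (run o (l ++ l')).1.
Proof.
rewrite foldl_cat; elim: l' (run o l) => //= i l' IH S.
apply: subset_trans (IH _); rewrite /hypergraphic_step.
by case: ifP => //= _; apply: subsetUr.
Qed.

(* In each component of the selected pairs at most one vertex has indegree 0,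
   so an arc between two vertices of indegree 0 joins two components. *)
Lemma run_forest o l : uniq o -> uniq l ->
  exists2 e, represents G (run o l).1 e &
    forall x y, connect (adjacent (e @: (run o l).1)) x y ->
      indegree (run o l).2 x == 0 -> indegree (run o l).2 y == 0 -> x = y.
Proof.
move=> uo; elim/last_ind: l => [_|l i IH].
  have /existsP[e eX] := hypergraphic_indep0 G; exists e => // x y.
  by rewrite imset0 => /connectP[[|z p] //=]; rewrite /adjacent inE andbF.
rewrite rcons_uniq => /andP[il /IH[e eX eI]]; rewrite foldl_rcons.
have := @run_selected o l (tnth o i); move: eX eI; case: (run o l) => S A /=.
move=> eX eI rS; rewrite /hypergraphic_step /=.
set r := tnth o i in rS *; set Q := arrived o i.+1; case: ifP; last by exists e.
set a := arc _ r => /and3P[rQ /[dup] a1 /indegree_eq0 a1' a2].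
have {}rS : r \notin S.
  by apply/negP => /rS[j jl /(tnth_inj uo) ij]; rewrite ij jl in il.
have [eQ _ _ arcE _] := ca (opt_indep Q).
have [eQ2 eQG _ _] := representsP _ _ _ eQ.
have SE : S :\ r = S by apply/setDidPl; rewrite disjoint_sym disjoints1.
have fE : edge (opt Q) r = [set a.1; a.2] by rewrite arcE.
have uv : a.1 != a.2.
  by have := eQ2 r rQ; rewrite fE cards2; case: eqP.
have uvN : ~~ connect (adjacent (e @: S)) a.1 a.2.
  by apply: contra uv => /eI-> //.
(* The new element is represented by its pair in the current optimum; earlier ones keep the pairs
   they already have. *)
exists (fun x => if x == r then edge (opt Q) r else e x) => /=.
  apply: represents_setU1; rewrite ?SE //.
  - rewrite fE; apply: contra uvN => uvS; apply: connect1.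
    by rewrite /adjacent uv.
  - exact: eQ2.
  - exact: eQG.
  - by rewrite fE; apply: forest_setU1 => //; case/representsP: eX.
move=> x y; rewrite imsetU1 eqxx.
have -> : [set if x == r then edge (opt Q) r else e x | x in S] = e @: S.
  by apply: eq_in_imset => z zS; case: eqP => // zr; rewrite -zr zS in rS.
rewrite fE => xy /indegree_eq0 x0 /indegree_eq0 y0.
have sub0 z : (forall b, b \in a |: A -> b.2 != z) -> indegree A z == 0.
  by move=> z0; apply/indegree_eq0 => b bA; apply: z0; rewrite inE bA orbT.
(* If the connection uses the new pair, [x] or [y] lies in the old component of [a.2]. Its only
   vertex of indegree 0 was [a.2], which the new arc now enters. *)
case/conn_setU1: xy => [/eI|[_ vy]|[xv _]]; first by apply; apply: sub0.
  have := y0 a (setU11 _ _); rewrite (eI _ _ vy a2) ?eqxx //; exact: sub0.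
have := x0 a (setU11 _ _); rewrite -(eI _ _ xv _ a2) ?eqxx //; exact: sub0.
Qed.

Lemma hypergraphic_forbidden_sets (p : K) :
  has_forbidden_sets (hypergraphic_indep G) p 2 (hypergraphic_algorithm G arc p).
Proof.
split=> //= [s o _ uo|s o sR uo|].
- have [|e eX _] := @run_forest o [seq i : 'I_#|R| <- enum 'I_#|R| | s <= i] uo.
    by rewrite filter_uniq // enum_uniq.
  exact: represents_indep eX.
- apply/pred0P => r /=; apply/negP => /andP[/run_selected[i]].
  rewrite mem_filter => /andP[si _] -> /(arrivedP _ _ uo)[j js /(tnth_inj uo)ij].
  by rewrite -ij ltnNge si in js.
(* The arc of [x] is taken in the optimum of [X], that is, as it was when [x] arrived, and the arc
   [a] of [r] in the optimum of [Y]. *)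
exists (fun X Y r => let a := arc (opt Y) r in
  [set x in opt X | (arc (opt X) x).2 == a.1] :|:
  [set x in opt X | (arc (opt X) x).2 == a.2]); split=> [X Y r _ _|].
  split.
    by apply/subsetP => x; rewrite !inE => /orP[]/andP[xX _];
       apply: (subsetP (opt_sub X)).
  apply: (leq_trans (leq_card_setU _ _)); rewrite -[2]/(1 + 1).
  by apply: leq_add; apply: (canonical_arcs_indegree _ ca).
move=> s o i si uo; set r := tnth o i => rO nF.
rewrite /hypergraphic_output; set l := [seq _ <- _ | _].
have sl : all (fun j : 'I_#|R| => s <= j) l by apply: filter_all.
have il : i \in l by rewrite mem_filter si mem_enum.
have lsort : sorted (fun j k : 'I_#|R| => j < k) l.
  apply: sorted_filter; first by move=> x y z; apply: ltn_trans.
  by rewrite -(@sorted_map _ _ val ltn) val_enum_ord iota_ltn_sorted.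
move: sl lsort; case/splitPr: il => l1 l2.
rewrite all_cat => /andP[/allP sl1 _].
rewrite sorted_pairwise; last by move=> x y z; apply: ltn_trans.
rewrite pairwise_cat allrel_consr => /andP[/andP[/allP l1i _] _].
set a := arc _ r in nF.
(* A selected arc that enters an end of [a] would come from a forbidden element. *)
have indeg0 v : v = a.1 \/ v = a.2 -> indegree (run o l1).2 v == 0.
  move=> va; apply/indegree_eq0 => b /run_arcs[j [jl1 jO ->]].
  have := nF j; rewrite (sl1 j jl1) (l1i j jl1) => /(_ isT).
  by apply: contra => /eqP hv; rewrite !inE jO hv; case: va => ->; rewrite eqxx ?orbT.
rewrite -cat1s catA; apply: (subsetP (run_mono _ _ _)).
by rewrite foldl_cat /= {1}/hypergraphic_step rO !indeg0 ?setU11; auto.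
Qed.

End ForbiddenSets.

(** * Counting arrival orders *)

(* The elements are drawn from the last position to the first one. *)
Lemma card_orders_ge (T : finType) (A : nat -> seq T -> {set T}) (w : nat -> nat) :
  (forall j l, uniq l -> size l + j.+1 = #|T| ->
     w j <= #|A j l :\: [set x in l]|) ->
  \prod_(j < #|T|) w j <=
  #|[set o : #|T|.-tuple T | uniq o &
      [forall j : 'I_#|T|, tnth o j \in A j (drop j.+1 o)]]|.
Proof.
move=> wA.
(* The suffix from position [m] on is fixed to [l]; conditions remain only for positions below
   [m]. *)
pose S m l := [set o : #|T|.-tuple T | [&& uniq o, drop m o == l &
  [forall j : 'I_#|T|, (j < m) ==> (tnth o j \in A j (drop j.+1 o))]]].
suff H m l : uniq l -> size l + m = #|T| -> \prod_(j < m) w j <= #|S m l|.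
  have := H #|T| [::] isT (add0n _); move/leq_trans; apply.
  apply: subset_leq_card; apply/subsetP => o; rewrite !inE => /and3P[-> _].
  by move/forallP => h; apply/forallP => j; have := h j; rewrite ltn_ord.
elim: m l => [|m IH] l ul szl.
  rewrite big_ord0 card_gt0; apply/set0Pn.
  have szT : size l == #|T| by rewrite -szl addn0.
  exists (Tuple szT); rewrite inE drop0 /= ul eqxx /=.
  by apply/forallP.
have mT : m < #|T| by rewrite -szl addnS ltnS leq_addl.
pose i := Ordinal mT.
have -> : #|S m.+1 l| = \sum_x #|[set o in S m.+1 l | tnth o i == x]|.
  rewrite -[LHS]sum1_card (partition_big (fun o : #|T|.-tuple T => tnth o i) predT) //=.
  apply: eq_bigr => x _; rewrite -[RHS]sum1_card; apply: eq_bigl => o.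
  by rewrite [in RHS]inE.
rewrite big_ord_recr /= mulnC.
(* Position [m] offers at least [w m] choices, and distinct choices give disjoint sets of orders. *)
apply: (@leq_trans (\sum_(x in A m l :\: [set x in l]) \prod_(j < m) w j)).
  by rewrite sum_nat_const leq_mul2r wA ?orbT.
rewrite [leqRHS](bigID (mem (A m l :\: [set x in l]))) /=.
apply: (@leq_trans (\sum_(x in A m l :\: [set x in l])
    #|[set o in S m.+1 l | tnth o i == x]|)); last exact: leq_addr.
apply: leq_sum => x /setDP[xA]; rewrite inE => xl.
apply: leq_trans (IH (x :: l) _ _) _; first by rewrite /= xl.
  by rewrite -szl addSnnS.
apply: subset_leq_card; apply/subsetP => o; rewrite !inE => /and3P[-> /eqP ol oA].
move: ol; rewrite (drop_nth x) ?size_tuple // => -[xE lE].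
have ox : tnth o i = x by rewrite (tnth_nth x).
rewrite lE ox !eqxx andbT /=; apply/forallP => j; rewrite ltnS leq_eqVlt.
apply/implyP => /orP[/eqP jm|jm]; last by have /forallP/(_ j)/implyP := oA; apply.
by rewrite (_ : j = i) ?ox ?lE //; apply: val_inj.
Qed.

(* A lower bound on the number of admissible choices at position [j] (counted from 0) when the
   sample has size [s] and the optimal element sits at position [i]. *)
Definition weight (s i j : nat) : nat :=
  if j < s then j.+1 else if j < i then j.-1 else if j == i then 1 else j.

(** A lower bound on the number of orders that select a given optimal element, summed over its
    position [i] after the sample. *)
Definition total_weight (n s : nat) : nat :=
  \sum_(i < n | s <= i) \prod_(j < n) weight s i j.

(** For [s >= 2] this is s! times the product of j - 1 over s <= j < n + 2. For [s < 2] both sides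
    vanish, the factor at position 1 being 0. *)
Lemma prod_weight_last s n : s <= n.+2 ->
  \prod_(j < n.+2) weight s n.+2 j = s * s.-1 * n`!.
Proof.
have sample k : \prod_(j < k) (if j < s then j.+1 else j.-1) = k`! \/ ~~ (k <= s).
  elim: k => [|k IH]; first by left; rewrite big_ord0.
  case: (leqP k.+1 s) => [ks|]; last by right.
  left; rewrite big_ord_recr /= ks factS mulnC; case: IH => [->//|].
  by rewrite (ltnW ks).
have -> k : \prod_(j < k) weight s k j = \prod_(j < k) (if j < s then j.+1 else j.-1).
  by apply: eq_bigr => j _; rewrite /weight ltn_ord.
elim: n => [|n IH] sn.
  by rewrite !big_ord_recr big_ord0 /=; case: s sn {sample} => [|[|[|]]].
move: sn; rewrite leq_eqVlt ltnS => /orP[/eqP sE|sn].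
  case: (sample n.+3) => [->|]; last by rewrite sE leqnn.
  by rewrite sE /= !factS; lia.
rewrite big_ord_recr /= IH // ltnNge sn /= factS; lia.
Qed.

(** One more position multiplies every old summand by [n]; the new summand, with the optimal element
    last, has final factor 1. *)
Lemma total_weightS n s : s <= n ->
  total_weight n.+1 s = total_weight n s * n + \prod_(j < n) weight s n j.
Proof.
move=> sn; rewrite /total_weight big_mkcond big_ord_recr /= sn; congr (_ + _).
  rewrite big_distrl [RHS]big_mkcond /=; apply: eq_bigr => i _.
  case: ifP => // si; rewrite big_ord_recr /= /weight.
  rewrite [n < s]ltnNge sn /= [n < i]ltnNge (ltnW (ltn_ord i)) /=.
  by rewrite (gtn_eqF (ltn_ord i)).
by rewrite big_ord_recr /= {2}/weight ltnNge sn ltnn eqxx muln1.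
Qed.

(** Behind the bound is the telescoping sum of 1 / (i (i - 1)); induction along [total_weightS]
    avoids divisions. *)
Lemma total_weight_ge n s : s <= n.+2 ->
  s * (n.+2 - s) * n`! <= total_weight n.+2 s.
Proof.
elim: n => [|n IH] sn.
  case: s sn => [|[|[|//]]] _ //.
  by rewrite /total_weight big_mkcond /= !big_ord_recr !big_ord0.
move: sn; rewrite leq_eqVlt ltnS => /orP[/eqP->|sn]; first by rewrite subnn muln0.
rewrite total_weightS // prod_weight_last //.
apply: (@leq_trans (s * (n.+2 - s) * n`! * n.+2 + s * s.-1 * n`!)).
  case: s sn {IH} => // s sn; rewrite factS /=.
  have -> : n.+3 - s.+1 = (n.+2 - s.+1).+1 by lia.
  have [d nE] : exists d, d = n.+2 - s.+1 by exists (n.+2 - s.+1).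
  rewrite -nE; have -> : n.+1 = s + d by lia.
  by rewrite leq_eqVlt; apply/orP; left; apply/eqP; ring.
by rewrite leq_add2r leq_mul2r IH ?orbT.
Qed.

(** With N = n + 2, the term equals N (N - 1) C(N - 2, s - 1) for 0 < s < N and vanishes at both
    ends, which leaves the expansion of (1 + 1)^n. *)
Lemma sum_bin_mul n :
  \sum_(s < n.+3) 'C(n.+2, s) * (s * (n.+2 - s)) = n.+2 * n.+1 * 2 ^ n.
Proof.
rewrite big_ord_recl big_ord_recr /= subnn mul0n !muln0 add0n addn0.
rewrite -[2]/(1 + 1) expnDn big_distrr /=; apply: eq_bigr => i _.
have := mul_bin_diag n.+2 i; have := mul_bin_down n.+1 i.
rewrite /= !exp1n !muln1 /bump /= add1n subSS => d1 d2.
by rewrite mulnCA mulnA -d2 -!mulnA d1; congr (_ * _); rewrite mulnC.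
Qed.

Local Open Scope ring_scope.

Lemma binomial_mean_ge (K : realType) (n : nat) (N : nat -> nat) : (0 < n)%N ->
  (forall s, (s <= n)%N -> (total_weight n s <= N s)%N) ->
  4^-1 <= \sum_(s < n.+1) binomial_pmf n (2^-1 : K) s * ((N s)%:R / (n`!)%:R).
Proof.
have pmfE k s : (s <= k)%N -> binomial_pmf k (2^-1 : K) s = 2^-1 ^+ k * 'C(k, s)%:R.
  move=> sk; rewrite /binomial_pmf (_ : unstable.onem _ = 2^-1); last first.
    by rewrite /unstable.onem; field.
  by rewrite -exprD subnKC // mulr_natr.
case: n => // -[|n] _ HN.
  (* With a single element, the empty sample alone contributes at least 1/2. *)
  have N0 := HN 0%N isT; rewrite big_ord_recl -[leLHS]addr0; apply: lerD.
    have {}N0 : (1 <= N 0%N)%N.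
      by move: N0; rewrite /total_weight big_mkcond big_ord_recr big_ord0 /= big_ord_recr big_ord0.
    rewrite pmfE // bin0 divr1 mulr1 expr1.
    have : 1%:R <= (N 0%N)%:R :> K by rewrite ler_nat.
    by move=> ?; lra.
  apply: sumr_ge0 => i _; rewrite mulr_ge0 ?divr_ge0 ?ler0n //.
  by rewrite binomial_pmf_ge0 //; apply/andP; split; lra.
apply: (@le_trans _ _ (\sum_(s < n.+3) 2^-1 ^+ n.+2 * (n`!)%:R / (n.+2`!)%:R *
    ('C(n.+2, s) * (s * (n.+2 - s)))%:R)).
  rewrite -mulr_sumr -natr_sum sum_bin_mul !factS !natrM natrX.
  have f0 : (n`!)%:R != 0 :> K by rewrite pnatr_eq0 -lt0n fact_gt0.
  have e2 : 2 ^+ n != 0 :> K by rewrite expf_neq0 // pnatr_eq0.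
  rewrite exprVn exprSr exprSr [leRHS](_ : _ = 4^-1) //.
  by field; rewrite f0 e2 nat1r -natrD !pnatr_eq0.
apply: ler_sum => s _; have sn : (s <= n.+2)%N by rewrite -ltnS.
rewrite pmfE // (natrM _ 'C(n.+2, s)) (natrM _ s).
have : (s * (n.+2 - s) * n`!)%:R <= (N s)%:R :> K.
  by rewrite ler_nat (leq_trans (total_weight_ge sn)) ?HN.
rewrite (natrM _ (s * _)) (natrM _ s) => sN.
rewrite [leLHS](_ : _ = 2^-1 ^+ n.+2 * 'C(n.+2, s)%:R *
  (s%:R * (n.+2 - s)%:R * n`!%:R / n.+2`!%:R)); last by ring.
apply: ler_wpM2l; first by rewrite mulr_ge0 ?exprn_ge0 ?invr_ge0 ?ler0n.
by apply: ler_wpM2r; rewrite ?invr_ge0 ?ler0n.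
Qed.

(** * Forbidden sets of size 2 give competitiveness 4 *)

Section ForbiddenSetsCompetitive.
Variables (K : realType) (disp : Order.disp_t) (R : finOrderType disp).
Variables (I : pred {set R}) (alg : algorithm K R).
Hypothesis opt_restrict : forall (Q : {set R}) r,
  r \in OPT I [set: R] -> r \in Q -> r \in OPT I Q.
Hypothesis alg_forbidden : has_forbidden_sets I 2^-1 2 alg.
Local Open Scope nat_scope.

Lemma selected_card_ge s r : r \in OPT I [set: R] ->
  total_weight #|R| s <=
  #|[set o : #|R|.-tuple R | uniq o & r \in output alg s o]|.
Proof.
move=> rO; have [_ _ _ [F [Fk Fsel]]] := alg_forbidden.
(* The default [set0] makes the size bound hold for all [X] and [Y]. *)
pose F' (X Y : {set R}) := if (r \in OPT I Y) && (X \subset Y :\ r) then F X Y r else set0.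
have F'k X Y : #|F' X Y| <= 2.
  by rewrite /F'; case: ifP => [/andP[rY XY]|_]; [case: (Fk _ _ _ rY XY) | rewrite cards0].
(* The case [r \in l] is excluded by the choices made at positions [j > i];
   [setT] keeps the lower bound on the number of choices true for every [l]. *)
pose A (i j : nat) (l : seq R) := if j < s then [set: R]
  (* Here [l] is the suffix after position [j], and dropping [i - j] more elements leaves the suffix
     after [i]; the complements are the sets arrived up to [j] and up to [i]. *)
  else if j < i then ~: F' (~: [set x in l]) (~: [set x in drop (i - j) l])
  else if j == i then if r \in l then [set: R] else [set r] else ~: [set r].
pose S i := [set o : #|R|.-tuple R | uniq o &
      [forall j : 'I_#|R|, tnth o j \in A i j (drop j.+1 o)]].
have SA (i : 'I_#|R|) : \prod_(j < #|R|) weight s i j <= #|S i|.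
  apply: card_orders_ge => j l ul szl.
  have cl : #|~: [set x in l]| = j.+1.
    have := cardsC [set x in l]; rewrite cardsE (card_uniqP ul) -szl.
    by move/addnI.
  rewrite /A /weight setDE; case: ifP => _; first by rewrite setTI cl.
  case: ifP => _.
    rewrite setIC -setDE cardsD cl.
    rewrite -subn1 -[j - 1]/(j.+1 - 2) leq_sub2l //.
    by apply: leq_trans (F'k _ _); apply: subset_leq_card; apply: subsetIr.
  case: ifP => _.
    case: ifP => rl; first by rewrite setTI cl.
    by rewrite card_gt0; apply/set0Pn; exists r; rewrite !inE eqxx rl.
  rewrite setIC -setDE; have := cardsD1 r (~: [set x in l]); rewrite cl.
  by case: (r \in _); lia.
have Ssel (i : 'I_#|R|) (o : #|R|.-tuple R) :
    s <= i -> o \in S i -> tnth o i = r /\ r \in output alg s o.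
  move=> si; rewrite inE => /andP[uo /forallP oA].
  have rdrop : r \notin drop i.+1 o.
    apply/negP => /(nthP r)[k]; rewrite size_drop size_tuple nth_drop => kR.
    have jR : i.+1 + k < #|R| by lia.
    have := oA (Ordinal jR); rewrite /A /=.
    have -> : (i.+1 + k < s) = false by apply/negbTE; rewrite -leqNgt; lia.
    have -> : (i.+1 + k < i) = false by apply/negbTE; rewrite -leqNgt; lia.
    rewrite gtn_eqF; last by rewrite addSn ltnS leq_addr.
    by rewrite !inE (tnth_nth r) /= => /eqP.
  have oi : tnth o i = r.
    have := oA i; rewrite /A ltnn eqxx ltnNge si /= (negbTE rdrop).
    by rewrite inE => /eqP.
  have rQ : r \in OPT I (arrived o i.+1).
    by apply: opt_restrict; rewrite // -oi arrivedE // inE oi inE.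
  split=> //; rewrite -oi; apply: Fsel => //; rewrite ?oi // => j /andP[sj ji].
  have := oA j; rewrite /A ltnNge sj ji /= inE drop_drop.
  rewrite (_ : i - j + j.+1 = i.+1); last by lia.
  rewrite -!arrivedE // /F' rQ /=; case: ifP => // /negP[].
  apply/subsetP => _ /(arrivedP _ _ uo)[k kj ->]; apply/setD1P; split.
    by rewrite -oi (inj_eq (tnth_inj uo)) -val_eqE neq_ltn (leq_ltn_trans _ ji).
  by apply/(arrivedP _ _ uo); exists k; rewrite // ltnS (leq_trans _ (ltnW ji)).
set Z := [set o : #|R|.-tuple R | _ & _].
(* In each order [r] occupies only one position, so the sum over positions counts no order twice. *)
apply: (@leq_trans (\sum_(i < #|R|) #|[set o in Z | tnth o i == r]|)).
  rewrite /total_weight big_mkcond; apply: leq_sum => i _; case: ifP => // si.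
  apply: (leq_trans (SA i)); apply: subset_leq_card; apply/subsetP => o oS.
  have [oi sel] := Ssel i o si oS.
  by move: oS; rewrite !inE oi eqxx sel => /andP[->].
have -> : \sum_(i < #|R|) #|[set o in Z | tnth o i == r]| =
          \sum_(o in Z) \sum_(i < #|R|) (tnth o i == r).
  rewrite exchange_big /=; apply: eq_bigr => i _.
  rewrite -[LHS]sum1_card big_mkcond [RHS]big_mkcond /=; apply: eq_bigr => o _.
  by rewrite [o \in [set _ in _ | _]]inE; case: (o \in Z); case: (_ == r).
rewrite -sum1_card; apply: leq_sum => o; rewrite inE => /andP[uo _].
have -> : \sum_(i < #|R|) (tnth o i == r) = #|[set i | tnth o i == r]|.
  rewrite -sum1_card [RHS]big_mkcond /=; apply: eq_bigr => i _.
  by rewrite inE; case: (_ == r).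
apply/card_le1_eqP => i j; rewrite !inE => /eqP ir /eqP jr.
by apply: (tnth_inj uo); rewrite ir jr.
Qed.

Lemma forbidden_sets_competitive : probability_competitive I 4 alg.
Proof.
move=> r rO; have [_ lawE _ _] := alg_forbidden.
pose N s := #|[set o : #|R|.-tuple R | uniq o & r \in output alg s o]|.
rewrite /pr_selected (eq_bigr (fun s : 'I_#|R|.+1 =>
  binomial_pmf #|R| (2^-1 : K) s * ((N s)%:R / (#|R| `!)%:R)))%R.
  apply: binomial_mean_ge => [|s _]; first by apply/card_gt0P; exists r.
  exact: selected_card_ge.
by move=> s _; rewrite lawE.
Qed.

End ForbiddenSetsCompetitive.

Theorem theorem6 (K : realType) (V : finType) (disp : Order.disp_t)
    (R : finOrderType disp) (G : R -> {set V})
    (edge : {set R} -> R -> {set V}) (root : {set R} -> V -> V)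
    (arc : {set R} -> R -> V * V) :
  canonical_arcs G edge root arc ->
  (forall p : K, 0 <= p <= 1 ->
     has_forbidden_sets (hypergraphic_indep G) p 2
       (hypergraphic_algorithm G arc p)) /\
  probability_competitive (hypergraphic_indep G) 4
    (hypergraphic_algorithm G arc (2^-1 : K)).
Proof.
move=> ca; split=> [p _|]; first exact: (hypergraphic_forbidden_sets ca).
apply: forbidden_sets_competitive; last exact: (hypergraphic_forbidden_sets ca).
apply: OPT_restrict.
- exact: hypergraphic_indep0.
- exact: hypergraphic_indepS.
- exact: hypergraphic_augment.
Qed.
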